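(* Let $\mathcal K$ be a constant (i.e., independent of $z$) skew-adjoint linear differential operator in $x$ acting on $\mathbb R^n$-valued functions, let $H=H(z,z_x,z_{xx},\dots)$ be a smooth differential function of $z$ of finite order $N$ (possibly also depending on $x$, which is suppressed), and let $\mathcal H=\int H\,\mathrm dx$. Let $\overline\nabla$ be a discrete gradient. Consider the Poisson system $$z_t=\mathcal K\frac{\delta\mathcal H}{\delta z}=\mathcal K E(H),\qquad E(H)=H_z-\partial_xH_{z_x}+\partial_{xx}H_{z_{xx}}-\cdots,\qquad(\mathrm P)$$ and the discrete gradient method with time step $\Delta t\ne0$ $$\frac{z_1-z_0}{\Delta t}=\mathcal K\left(\overline{H_z}-\partial_x\overline{H_{z_x}}+\partial_{xx}\overline{H_{z_{xx}}}-\cdots\right).\qquad(\mathrm D)$$ Then (P) has an energy conservation law with conserved density $H$ whose flux is a quadratic form in the derivatives of $H$, and (D) has a discrete energy conservation law with conserved density $H$ and flux given by the same quadratic form with derivatives of $H$ replaced by discrete gradients. That is, there is a quadratic differential form $Q$ such that: (i) every smooth solution $z(x,t)$ of (P) satisfies $$\partial_t H+\partial_x\big(Q(h)\big)=0,\qquad h=(H_z,H_{z_x},H_{z_{xx}},\dots),$$ where $H$ and its derivatives are evaluated at $(z,z_x,z_{xx},\dots)$; (ii) every pair of smooth functions $z_0,z_1$ of $x$ satisfying (D) satisfies $$\frac{H(z_1,z_{1x},z_{1xx},\dots)-H(z_0,z_{0x},z_{0xx},\dots)}{\Delta t}+\partial_x\big(Q(\overline h)\big)=0,\qquad\overline h=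(\overline{H_z},\overline{H_{z_x}},\overline{H_{z_{xx}}},\dots).$$
   Context: Discrete gradient: on a vector space $V$ with inner product $a^\top b$, a discrete gradient assigns to each smooth $H\colon V\to\mathbb R$ a map $\overline\nabla H\colon V\times V\to V$ with $$(v_1-v_0)^\top\overline\nabla H(v_0,v_1)=H(v_1)-H(v_0)\quad\text{for all }v_0,v_1\in V$$ (the discrete gradient axiom). (For consistency one usually also requires $\overline\nabla H(v,v)=\nabla H(v)$, but this is not needed for conservation properties.) We assume smoothness sufficient for all $x$-derivatives written to exist. Here $V=(\mathbb R^n)^{N+1}$ with variables $(z,z_x,\dots,\partial_x^Nz)$. $H_z,H_{z_x},H_{z_{xx}},\dots\in\mathbb R^n$ are the partial gradients of $H$ with respect to $z,z_x,z_{xx},\dots$, and $\overline{H_z},\overline{H_{z_x}},\overline{H_{z_{xx}}},\dots\in\mathbb R^n$ are the corresponding components of $\overline\nabla H$. For functions $z_0,z_1$ of $x$ they are evaluated pointwise in $x$ at $v_i=(z_i(x),z_{ix}(x),z_{ixx}(x),\dots)$, $i=0,1$; if $H$ depends explicitly on $x$, the discrete gradient is taken of $H$ with $x$ held fixed. $\partial_x$ denotes the total $x$-derivative. $E$ is called the Euler operator. $\mathcal K=\sum_kK_k\,\partial_x^k$ (finite sum, $n\times n$ matrix coefficients independent of $z$) is skew-adjoint if its formal adjoint $\mathcal K^*a=\sum_k(-\partial_x)^k(K_k^\top a)$ satisfies $\mathcal K^*=-\mathcal K$. Solutions are smooth functions on an open interval in $x$ (times an open interval in $t$, in the continuous case);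 no boundary conditions are imposed, and all statements are local in $x$. Quadratic differential form: an expression $Q(h)=\sum_{j,k\ge0}(\partial_x^jh)^\top C_{jk}\,\partial_x^kh$ (finite sum), for smooth functions $h$ of $x$ with values in $(\mathbb R^n)^{N+1}$, with coefficient matrices $C_{jk}$ independent of $z$ (constant if the coefficients of $\mathcal K$ are constant in $x$; otherwise they may depend on $x$). *)

(* Defs.v *)
From HB Require Import structures.
From mathcomp Require Import all_boot all_order all_algebra.
From mathcomp Require Import all_classical all_reals all_analysis.

Set Implicit Arguments.
Unset Strict Implicit.
Unset Printing Implicit Defensive.
Import Order.TTheory GRing.Theory Num.Theory.
Import numFieldNormedType.Exports.
Local Open Scope ring_scope.
Local Open Scope classical_set_scope.

(* Vectors of R^n are columns, and (R^n)^(N+1) is 'M[R]_(n, N.+1): column k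
   holds the variable that stands for the k-th x-derivative. *)

(* C^oo on an open set U: every iterated directional derivative is (Frechet)
   differentiable at every point of U. *)
Definition smooth_on (R : realType) (E W : normedModType R) (U : set E)
    (f : E -> W) : Prop :=
  forall (vs : seq E) (x : E), U x ->
    differentiable (foldr (fun v (g : E -> W) => 'D_v g) f vs) x.

Definition open_interval (R : realType) (X : set R) : Prop :=
  open X /\ is_interval X.

Definition diff_times_on (R : realType) (W : normedModType R) (r : nat)
    (X : set R) (f : R -> W) : Prop :=
  forall k, (k < r)%N -> forall x, X x -> derivable (derive1n k f) x 1.

Definition jet (R : realType) (n N : nat) (z : R -> 'cV[R]_n) (x : R) :
    'M[R]_(n, N.+1) :=
  \matrix_(i < n, k < N.+1) (derive1n k z x) i 0.

Definition dot (R : realType) (m p : nat) (a b : 'M[R]_(m, p)) : R :=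
  \tr (a^T *m b).

Definition grad (R : realType) (m p : nat) (f : 'M[R]_(m, p) -> R)
    (v : 'M[R]_(m, p)) : 'M[R]_(m, p) :=
  \matrix_(i < m, k < p) 'D_(delta_mx i k) f v.

Definition discrete_gradient (R : realType) (m p : nat)
    (dg : ('M[R]_(m, p) -> R) -> 'M[R]_(m, p) -> 'M[R]_(m, p) -> 'M[R]_(m, p)) :
    Prop :=
  forall f : 'M[R]_(m, p) -> R, smooth_on setT f ->
    forall v0 v1, dot (v1 - v0) (dg f v0 v1) = f v1 - f v0.

(* h_0 - d_x h_1 + d_xx h_2 - ... for functions h_k of x. Applied to the
   partial gradients (or discrete gradients) of H evaluated along functions of
   x, so that the total x-derivative is the derivative of the composite. *)
Definition euler (R : realType) (n N : nat) (h : R -> 'M[R]_(n, N.+1)) (x : R) :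
    'cV[R]_n :=
  \sum_(k < N.+1) (-1) ^+ k *: derive1n k (fun y => col k (h y)) x.

Definition diffop (R : realType) (n r : nat) (K : 'I_r.+1 -> R -> 'M[R]_n)
    (a : R -> 'cV[R]_n) (x : R) : 'cV[R]_n :=
  \sum_(k < r.+1) K k x *m derive1n k a x.

Definition diffop_adj (R : realType) (n r : nat) (K : 'I_r.+1 -> R -> 'M[R]_n)
    (a : R -> 'cV[R]_n) (x : R) : 'cV[R]_n :=
  \sum_(k < r.+1) (-1) ^+ k *: derive1n k (fun y => (K k y)^T *m a y) x.

Definition skew_adjoint_on (R : realType) (n r : nat) (X : set R)
    (K : 'I_r.+1 -> R -> 'M[R]_n) : Prop :=
  forall a : R -> 'cV[R]_n, smooth_on X a ->
    forall x, X x -> diffop_adj K a x = - diffop K a x.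

(* mxvec flattens (R^n)^(N+1) to R^(n(N+1)), so that C j k is a plain square
   matrix and each summand is a scalar, the entry of a 1 x 1 product. *)
Definition quad_diff_form (R : realType) (m p q : nat)
    (C : 'I_q.+1 -> 'I_q.+1 -> R -> 'M[R]_(m * p)) (h : R -> 'M[R]_(m, p))
    (x : R) : R :=
  \sum_(j < q.+1) \sum_(k < q.+1)
    (mxvec (derive1n j h x) *m C j k x *m (mxvec (derive1n k h x))^T) 0 0.

Definition constant_on (R : realType) (T : Type) (X : set R) (f : R -> T) : Prop :=
  forall x y, X x -> X y -> f x = f y.

(* Main.v *)
Require Import Defs.
From HB Require Import structures.
From mathcomp Require Import all_boot all_order all_algebra.
From mathcomp Require Import all_classical all_reals all_analysis.
From mathcomp Require Import ring zify.
Import Order.TTheory GRing.Theory Num.Theory.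
Import numFieldNormedType.Exports.
Local Open Scope ring_scope.
Local Open Scope classical_set_scope.

Set Implicit Arguments.
Unset Strict Implicit.
Unset Printing Implicit Defensive.

(** Both conservation laws are instances of one identity about an arbitrary
    function h of x with components h_0, ..., h_N, gradient or not.  Put
    e = E(h) = h_0 - d h_1 + d^2 h_2 - ... and w = K e, where d is the
    x-derivative.  Integrating the sum of the h_k . d^k w by parts moves every
    derivative from w to h, which produces e and leaves e . K e plus an exact
    derivative.  Integrating e . K e by parts moves the derivatives of K to the
    other factor, which leaves (K^* e) . e = - e . K e plus an exact derivative,
    so that e . K e is itself half an exact derivative.  Altogether
      the sum over k of h_k . d^k (K E(h)) = - d (Q(h)),
    where Q(h) gathers the boundary terms of the two integrations by parts.
    This is [energy_flux].  Since e and w are linear in the jet of h, Q is a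
    quadratic differential form, and its coefficients are built from those of K
    by sums, products and derivatives, so they are smooth, and constant when K
    is.

    For a solution of the evolution equation, the chain rule and the symmetry of
    mixed partial derivatives give d_t H as the sum of the h_k . d^k z_t, where
    h is the gradient of H and z_t = K E(h).  For the discrete gradient method,
    the discrete gradient axiom gives the increment of H as the sum of the
    h_k . d^k (z_1 - z_0), where h is the discrete gradient and
    z_1 - z_0 = dt K E(h).  The identity applies to both.

    Two points need care.  Skew-adjointness is tested on smooth functions only,
    whereas h may be differentiable finitely often; it still applies because the
    identity K^* a = - K a is linear in the jet of a, and every jet at a point
    is the jet of a polynomial ([linear_jet_form_eq0]).  The symmetry of
    second derivatives ([derive_commute]) comes from the mean value theorem
    applied twice to a second difference. *)

(** * Functions of one variable *)

Section OneVariable.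
Context {R : realType}.
Implicit Types (J X : set R).

Lemma open_near_eq (E : normedModType R) (T : Type) (U : set E) (f g : E -> T) x :
  open U -> U x -> {in U, f =1 g} -> \near x, f x = g x.
Proof.
move=> Uo Ux fg; near=> y; apply: fg; rewrite inE.
by near: y; exact: open_nbhs_nbhs.
Unshelve. all: by end_near. Qed.

Lemma derivable_eq_on {W : normedModType R} (J : set R) (f g : R -> W) x :
  open J -> J x -> {in J, f =1 g} -> derivable f x 1 -> derivable g x 1.
Proof. by move=> Jo Jx fg; apply: near_eq_derivable; exact: open_near_eq fg. Qed.

Lemma derive1_eq_on {W : normedModType R} (J : set R) (f g : R -> W) :
  open J -> {in J, f =1 g} -> {in J, derive1 f =1 derive1 g}.
Proof.
move=> Jo fg x; rewrite inE => Jx.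
by rewrite !derive1E; apply: near_eq_derive; exact: open_near_eq fg.
Qed.

Lemma derive1n_eq_on {W : normedModType R} (J : set R) (f g : R -> W) k :
  open J -> {in J, f =1 g} -> {in J, derive1n k f =1 derive1n k g}.
Proof.
by move=> Jo fg; elim: k => [//|k IH]; rewrite !derive1nS; exact: derive1_eq_on.
Qed.

Lemma diff_times_on_eq {W : normedModType R} (J : set R) (f g : R -> W) r :
  open J -> {in J, f =1 g} -> diff_times_on r J f -> diff_times_on r J g.
Proof.
move=> Jo fg df k kr x Jx.
by apply: (derivable_eq_on Jo Jx _ (df k kr x Jx)); exact: derive1n_eq_on.
Qed.

Lemma diff_times_onS {W : normedModType R} (J : set R) (f : R -> W) r :
  diff_times_on r.+1 J f <->
  (forall x, J x -> derivable f x 1) /\ diff_times_on r J (derive1 f).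
Proof.
split=> [df|[d0 df] [|k] kr x Jx].
- split=> [x Jx|k kr x Jx]; first by have := df 0%N isT x Jx.
  by rewrite -derive1Sn; exact: df.
- exact: d0.
- by rewrite derive1Sn; apply: df.
Qed.

Lemma diff_times_on_leq {W : normedModType R} (J : set R) (f : R -> W) r s :
  (r <= s)%N -> diff_times_on s J f -> diff_times_on r J f.
Proof. by move=> rs df k kr; apply: df; exact: leq_trans rs. Qed.

Lemma diff_times_on_subset {W : normedModType R} J J' (f : R -> W) r :
  J `<=` J' -> diff_times_on r J' f -> diff_times_on r J f.
Proof. by move=> JJ' df k kr x Jx; apply: df => //; exact: JJ'. Qed.

Lemma diff_times_on_derive1n {W : normedModType R} (J : set R) (f : R -> W) r k :
  diff_times_on (r + k) J f -> diff_times_on r J (derive1n k f).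
Proof.
move=> df l lr x Jx; rewrite /derive1n -iterD; apply: df => //.
by rewrite ltn_add2r.
Qed.

Lemma derive1_mx {m p} (M : R -> 'M[R]_(m, p)) x i j :
  derivable M x 1 -> derive1 M x i j = derive1 (fun y => M y i j) x.
Proof. by move=> dM; rewrite !derive1E derive_mx// mxE. Qed.

(** The values of the derivatives agree on [J] only as far as the function is
    known to be differentiable, hence the bound on the order. *)
Lemma derive1n_mx {m p} J (M : R -> 'M[R]_(m, p)) r i j :
  open J -> diff_times_on r J M -> forall k, (k <= r)%N ->
  {in J, (fun x => derive1n k M x i j) =1 derive1n k (fun x => M x i j)}.
Proof.
move=> Jo dM; elim=> [//|k IH] kr x; rewrite inE => Jx.
rewrite !derive1nS derive1_mx; last exact: dM.
by apply: (derive1_eq_on Jo); [exact/IH/ltnW | rewrite inE].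
Qed.

Lemma diff_times_on_mx {m p} J (M : R -> 'M[R]_(m, p)) r : open J ->
  diff_times_on r J M <-> forall i j, diff_times_on r J (fun x => M x i j).
Proof.
move=> Jo; split=> [dM i j k kr x Jx|].
  apply: (derivable_eq_on Jo Jx); first exact: (derive1n_mx i j Jo dM (ltnW kr)).
  by have /derivable_mxP/(_ i j) := dM k kr x Jx.
elim: r => [|r IH] dM; first by move=> k; rewrite ltn0.
have dMr : diff_times_on r J M.
  by apply: IH => i j; exact: diff_times_on_leq (dM i j).
move=> k; rewrite ltnS => kr x Jx; apply/derivable_mxP => i j.
apply: (derivable_eq_on Jo Jx _ (dM i j k kr x Jx)) => y Jy.
by rewrite (derive1n_mx _ _ Jo dMr).
Qed.

(** * Sums and products in one variable *)

Lemma diff_times_on_cst {W : normedModType R} J (w : W) r :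
  diff_times_on r J (fun _ => w).
Proof.
elim: r w => [|r IH] w; first by move=> k; rewrite ltn0.
apply/diff_times_onS; split=> [x _|]; first exact: derivable_cst.
rewrite [derive1 _](_ : _ = fun _ => 0); first exact: IH.
by apply/funext => x; rewrite derive1_cst.
Qed.

Lemma derive1D {W : normedModType R} (f g : R -> W) x :
  derivable f x 1 -> derivable g x 1 ->
  derive1 (fun y => f y + g y) x = derive1 f x + derive1 g x.
Proof. by move=> df dg; rewrite !derive1E deriveD. Qed.

Lemma derive1M (f g : R -> R) x : derivable f x 1 -> derivable g x 1 ->
  derive1 (fun y => f y * g y) x = derive1 f x * g x + f x * derive1 g x.
Proof.
move=> df dg; rewrite !derive1E.
by have := deriveM df dg => /= ->; rewrite addrC -![_ *: _]/(_ * _) [X in X + _]mulrC.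
Qed.

Lemma diff_times_onD {W : normedModType R} J (f g : R -> W) r : open J ->
  diff_times_on r J f -> diff_times_on r J g ->
  diff_times_on r J (fun x => f x + g x).
Proof.
move=> Jo; elim: r f g => [|r IH] f g; first by move=> _ _ k; rewrite ltn0.
move=> /diff_times_onS[df df'] /diff_times_onS[dg dg'].
apply/diff_times_onS; split=> [x Jx|].
  by apply: derivableD; [exact: df|exact: dg].
apply: (diff_times_on_eq Jo _ (IH _ _ df' dg')) => x; rewrite inE => Jx.
by rewrite derive1D//; [exact: df|exact: dg].
Qed.

Lemma diff_times_onM J (f g : R -> R) r : open J ->
  diff_times_on r J f -> diff_times_on r J g ->
  diff_times_on r J (fun x => f x * g x).
Proof.
move=> Jo; elim: r f g => [|r IH] f g; first by move=> _ _ k; rewrite ltn0.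
move=> dfr dgr.
have /diff_times_onS[df df'] := dfr; have /diff_times_onS[dg dg'] := dgr.
have {}dfr := diff_times_on_leq (leqnSn r) dfr.
have {}dgr := diff_times_on_leq (leqnSn r) dgr.
apply/diff_times_onS; split=> [x Jx|].
  by apply: derivableM; [exact: df|exact: dg].
apply: (diff_times_on_eq Jo _
  (diff_times_onD Jo (IH _ _ df' dgr) (IH _ _ dfr dg'))).
by move=> x; rewrite inE => Jx; rewrite derive1M//; [exact: df|exact: dg].
Qed.

Lemma diff_times_on_sum {W : normedModType R} J (I : Type) (s : seq I)
    (f : I -> R -> W) r : open J -> (forall i, diff_times_on r J (f i)) ->
  diff_times_on r J (fun x => \sum_(i <- s) f i x).
Proof.
move=> Jo df; elim: s => [|i s IH].
  under eq_fun do rewrite big_nil; exact: diff_times_on_cst.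
by under eq_fun do rewrite big_cons; exact: diff_times_onD.
Qed.

Lemma derivable_sum_fun {W : normedModType R} (I : Type) (s : seq I)
    (f : I -> R -> W) x : (forall i, derivable (f i) x 1) ->
  derivable (fun y => \sum_(i <- s) f i y) x 1.
Proof.
move=> df; elim: s => [|i s IH].
  under eq_fun do rewrite big_nil.
  exact: derivable_cst.
by under eq_fun do rewrite big_cons; exact: derivableD.
Qed.

Lemma derive1_sum {W : normedModType R} (I : Type) (s : seq I)
    (f : I -> R -> W) x : (forall i, derivable (f i) x 1) ->
  derive1 (fun y => \sum_(i <- s) f i y) x = \sum_(i <- s) derive1 (f i) x.
Proof.
move=> df; elim: s => [|i s IH].
  by under eq_fun do rewrite big_nil; rewrite big_nil derive1_cst.
under eq_fun do rewrite big_cons.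
by rewrite derive1D// ?big_cons ?IH//; exact: derivable_sum_fun.
Qed.

Lemma derive1Zl (c : R) (f : R -> R) x :
  derivable f x 1 -> derive1 (fun y => c * f y) x = c * derive1 f x.
Proof.
move=> df; rewrite (derive1M (derivable_cst c x 1) df).
by rewrite derive1_cst mul0r add0r.
Qed.

Lemma derivableZl (c : R) (f : R -> R) x :
  derivable f x 1 -> derivable (fun y => c * f y) x 1.
Proof. by move=> df; exact: (derivableM (derivable_cst c x 1) df). Qed.

(** * Smoothness in one variable *)

(** In one variable the directional derivative along v is v times the ordinary
    derivative, so the iterated directional derivatives are multiples of the
    ordinary iterated derivatives. *)
Lemma smooth_on1P {W : normedModType R} J (f : R -> W) : open J ->
  smooth_on J f <-> forall k, diff_times_on k J f.
Proof.
move=> Jo; split=> [sf k l _ x Jx|df vs].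
  apply/derivable1_diffP; have := sf (nseq l 1) x Jx.
  congr (differentiable _ x); elim: l => //= l ->.
  by rewrite -/(derive1n _ _); apply/funext => y; rewrite derive1E.
have {df}: exists2 g : R -> W, (forall k, diff_times_on k J g) &
    {in J, g =1 foldr (fun v g => 'D_v g) f vs}.
  elim: vs => [|v vs [g dg ge]]/=; first by exists f.
  exists (fun y => v *: derive1 g y).
    move=> k.
    have : diff_times_on k J (derive1 g) by have /diff_times_onS[] := dg k.+1.
    elim: k (derive1 g) => [|k IH] u; first by move=> _ l; rewrite ltn0.
    move=> /diff_times_onS[du du']; apply/diff_times_onS; split.
      by move=> y Jy; apply: derivableZ; exact: du.
    apply: (diff_times_on_eq Jo _ (IH _ du')) => y; rewrite inE => Jy.
    by rewrite !derive1E deriveZ//; exact: du.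
  move=> y; rewrite inE => Jy.
  rewrite -(near_eq_derive _ (open_near_eq Jo Jy ge)).
  have dgy : differentiable g y by apply/derivable1_diffP; exact: (dg 1%N 0%N isT).
  rewrite derive1E !deriveE//.
  by rewrite -[v in RHS]mulr1 -[v * 1]/(v *: (1 : R^o)) linearZ.
move=> [g dg ge] x Jx; apply/derivable1_diffP.
by apply: (derivable_eq_on Jo Jx ge); exact: (dg 1%N 0%N isT).
Qed.

End OneVariable.

(** * Jet forms *)

Section JetForms.
Context {R : realType} (X : set R) (B : Prop) (Xo : open X).

(** The coefficients of the flux must be smooth, and constant as soon as those
    of the operator are.  Both properties are stable under sums, products and
    derivatives, so they are carried along together; the proposition [B] stands
    for constancy of the operator. *)
Definition coefficient (c : R -> R) :=
  (forall k, diff_times_on k X c) /\ (B -> constant_on X c).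

Lemma coefficient_cst (w : R) : coefficient (fun _ => w).
Proof. by split=> [k|_ x y]//; exact: diff_times_on_cst. Qed.

Lemma coefficientD f g :
  coefficient f -> coefficient g -> coefficient (fun x => f x + g x).
Proof.
move=> [df cf] [dg cg]; split=> [k|b x y Xx Xy]; first exact: diff_times_onD.
by rewrite (cf b x y)// (cg b x y).
Qed.

Lemma coefficientM f g :
  coefficient f -> coefficient g -> coefficient (fun x => f x * g x).
Proof.
move=> [df cf] [dg cg]; split=> [k|b x y Xx Xy]; first exact: diff_times_onM.
by rewrite (cf b x y)// (cg b x y).
Qed.

Lemma coefficient_derive1 f : coefficient f -> coefficient (derive1 f).
Proof.
move=> [df cf]; split=> [k|b x y Xx Xy].
  by have /diff_times_onS[] := df k.+1.
suff f0 z : X z -> derive1 f z = 0 by rewrite !f0.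
move=> Xz; rewrite -[RHS](derive1_cst (f x) z).
apply: (derive1_eq_on Xo); last by rewrite inE.
by move=> u; rewrite inE => Xu; exact: cf.
Qed.

Section Fixed.
Context {m p : nat}.
Implicit Types (J : set R) (h : R -> 'M[R]_(m, p)).

Definition admissible q J h := [/\ open J, J `<=` X & diff_times_on q J h].

Lemma admissible_leq q s J h : (q <= s)%N -> admissible s J h -> admissible q J h.
Proof. by move=> qs [Jo JX dh]; split=> //; exact: diff_times_on_leq dh. Qed.

(** A scalar linear differential operator of order at most [q], as a property
    of a functional: only its values at [q] times differentiable functions are
    prescribed, so that an operator need not be put in this form by hand.
    Coordinates are flattened by [mxvec] as in [quad_diff_form]. *)
Definition linear_jet_form q (L : (R -> 'M[R]_(m, p)) -> R -> R) :=
  exists c : nat -> 'I_(m * p) -> R -> R,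
    (forall j a, coefficient (c j a)) /\
    forall J h, admissible q J h -> {in J, forall x, L h x =
      \sum_(j < q.+1) \sum_a c j a x * mxvec (derive1n j h x) 0 a}.

Lemma linear_jet_form_eq q L L' : linear_jet_form q L ->
  (forall J h, admissible q J h -> {in J, L' h =1 L h}) -> linear_jet_form q L'.
Proof.
move=> [c [cc Lc]] LL'; exists c; split=> // J h hJ x Jx.
by rewrite (LL' J) ?(Lc J).
Qed.

Lemma linear_jet_form_leq q s L :
  (q <= s)%N -> linear_jet_form q L -> linear_jet_form s L.
Proof.
move=> qs [c [cc Lc]].
exists (fun j a x => if (j < q.+1)%N then c j a x else 0); split.
  by move=> j a; case: (j < q.+1)%N => //; exact: coefficient_cst.
move=> J h hJ x Jx; rewrite (Lc J)//; last exact: admissible_leq hJ.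
rewrite (big_ord_widen s.+1 (fun j =>
  \sum_a c j a x * mxvec (derive1n j h x) 0 a)) ?ltnS// big_mkcond/=.
apply: eq_bigr => j _; case: ifP => // _.
by rewrite big1// => a _; rewrite mul0r.
Qed.

Lemma linear_jet_form0 q : linear_jet_form q (fun _ _ => 0).
Proof.
exists (fun _ _ _ => 0); split=> [j a|J h hJ x Jx]; first exact: coefficient_cst.
by rewrite big1// => j _; rewrite big1// => a _; rewrite mul0r.
Qed.

Lemma linear_jet_formD q L L' : linear_jet_form q L -> linear_jet_form q L' ->
  linear_jet_form q (fun h x => L h x + L' h x).
Proof.
move=> [c [cc Lc]] [d [cd Ld]]; exists (fun j a x => c j a x + d j a x).
split=> [j a|J h hJ x Jx]; first exact: coefficientD.
rewrite (Lc J)// (Ld J)// -big_split/=; apply: eq_bigr => j _.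
by rewrite -big_split/=; apply: eq_bigr => a _; rewrite mulrDl.
Qed.

Lemma linear_jet_form_sum q (I : Type) (s : seq I) L :
  (forall i, linear_jet_form q (L i)) ->
  linear_jet_form q (fun h x => \sum_(i <- s) L i h x).
Proof.
move=> lL; elim: s => [|i s IH].
  by apply: linear_jet_form_eq (linear_jet_form0 q) _ => J h hJ x Jx; rewrite big_nil.
apply: linear_jet_form_eq (linear_jet_formD (lL i) IH) _ => J h hJ x Jx.
by rewrite big_cons.
Qed.

Lemma linear_jet_formM q c L : coefficient c -> linear_jet_form q L ->
  linear_jet_form q (fun h x => c x * L h x).
Proof.
move=> cc [d [cd Ld]]; exists (fun j a x => c x * d j a x).
split=> [j a|J h hJ x Jx]; first exact: coefficientM.
rewrite (Ld J)// mulr_sumr; apply: eq_bigr => j _.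
by rewrite mulr_sumr; apply: eq_bigr => a _; rewrite mulrA.
Qed.

Lemma linear_jet_form_jet j a :
  linear_jet_form j (fun h x => mxvec (derive1n j h x) 0 a).
Proof.
exists (fun k b _ => ((k == j) && (b == a))%:R); split=> [k b|J h hJ x Jx].
  exact: coefficient_cst.
rewrite big_ord_recr/= big1 ?add0r => [|i _]; last first.
  by rewrite big1// => b _; rewrite (ltn_eqF (ltn_ord i)) mul0r.
rewrite (bigD1 a)//= !eqxx mul1r big1 ?addr0// => b /negPf->.
by rewrite andbF mul0r.
Qed.

Lemma linear_jet_form_coord i k : linear_jet_form 0 (fun h x => h x i k).
Proof.
apply: linear_jet_form_eq (linear_jet_form_jet 0 (mxvec_index i k)) _.
by move=> J h hJ x Jx; rewrite mxvecE.
Qed.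

Lemma mxvec_entry (a : 'I_(m * p)) :
  exists ik, forall M : 'M[R]_(m, p), mxvec M 0 a = M ik.1 ik.2.
Proof. by case/mxvec_indexP: a => i k; exists (i, k) => M; rewrite mxvecE. Qed.

Lemma derivable_jet q J h j a x : admissible q J h -> (j < q)%N -> J x ->
  derivable (fun y => mxvec (derive1n j h y) 0 a) x 1 /\
  derive1 (fun y => mxvec (derive1n j h y) 0 a) x = mxvec (derive1n j.+1 h x) 0 a.
Proof.
move=> [Jo _ dh] jq Jx; have [[i k] /= e] := mxvec_entry a.
under eq_fun do rewrite e.
have dj := dh j jq x Jx; split; first by have /derivable_mxP := dj.
by rewrite e derive1_mx.
Qed.

(** By the product rule; differentiating the jet raises the order by one. *)
Lemma linear_jet_form_derive1 q L :
  linear_jet_form q L -> linear_jet_form q.+1 (fun h => derive1 (L h)).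
Proof.
move=> [c [cc Lc]].
pose u (j : nat) a (h : R -> 'M[R]_(m, p)) x := mxvec (derive1n j h x) 0 a.
apply: (@linear_jet_form_eq _ (fun h x => \sum_(j < q.+1) \sum_a
    (derive1 (c j a) x * u j a h x + c j a x * u j.+1 a h x))).
  apply: linear_jet_form_sum => j; apply: linear_jet_form_sum => a.
  apply: linear_jet_formD; apply: linear_jet_formM => //.
  - exact: coefficient_derive1.
  - by apply: linear_jet_form_leq (linear_jet_form_jet j a); exact: ltnW.
  - exact: linear_jet_form_leq (linear_jet_form_jet j.+1 a).
move=> J h hJ x; rewrite inE => Jx; have [Jo JX dh] := hJ.
have Jx' : x \in J by rewrite inE.
rewrite (derive1_eq_on Jo (Lc J h (admissible_leq (leqnSn q) hJ)) Jx').
have dc j a : derivable (c j a) x 1 by apply: (cc j a).1 1%N 0%N isT x (JX x Jx).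
have du (j : 'I_q.+1) a : derivable (u j a h) x 1.
  by have [] := derivable_jet a hJ (ltn_ord j) Jx.
have dcu (j : 'I_q.+1) a : derivable (fun y => c j a y * u j a h y) x 1.
  exact: derivableM.
rewrite derive1_sum => [|j]; last exact: derivable_sum_fun.
apply: eq_bigr => j _; rewrite derive1_sum//; apply: eq_bigr => a _.
rewrite (derive1M (dc j a) (du j a)); congr (_ + _ * _).
by have [] := derivable_jet a hJ (ltn_ord j) Jx.
Qed.

Lemma linear_jet_form_derive1n q s L :
  linear_jet_form q L -> linear_jet_form (q + s) (fun h => derive1n s (L h)).
Proof.
move=> lL; elim: s => [|s IH]; first by rewrite addn0.
by rewrite addnS; apply: linear_jet_form_derive1.
Qed.

Lemma linear_jet_form_diff q s L J h : linear_jet_form q L ->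
  admissible (q + s) J h -> diff_times_on s J (L h).
Proof.
move=> [c [cc Lc]] hJ; have [Jo JX dh] := hJ.
pose f x := \sum_(j < q.+1) \sum_a c j a x * mxvec (derive1n j h x) 0 a.
apply: (@diff_times_on_eq _ _ J f) => //.
  by move=> x Jx; rewrite (Lc J)//; apply: admissible_leq hJ; exact: leq_addr.
apply: diff_times_on_sum => // j; apply: diff_times_on_sum => // a.
apply: diff_times_onM => //.
  by apply: diff_times_on_subset JX _; exact: (cc j a).1.
have [[i k] /= e] := mxvec_entry a.
under eq_fun do rewrite e.
have /diff_times_on_mx : diff_times_on s J (derive1n j h); last exact.
apply/diff_times_on_derive1n/(diff_times_on_leq _ dh).
by rewrite addnC leq_add2r -ltnS.
Qed.

(** Products of two linear jet forms are of this kind, which is why the flux is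
    quadratic ([quadratic_jet_formM]). *)
Definition quadratic_jet_form q (F : (R -> 'M[R]_(m, p)) -> R -> R) :=
  exists C : 'I_q.+1 -> 'I_q.+1 -> R -> 'M[R]_(m * p),
    (forall j k a b, coefficient (fun x => C j k x a b)) /\
    forall J h, admissible q J h -> {in J, F h =1 quad_diff_form C h}.

Lemma quad_diff_formE q (C : 'I_q.+1 -> 'I_q.+1 -> R -> 'M[R]_(m * p)) h x :
  quad_diff_form C h x = \sum_(j < q.+1) \sum_(k < q.+1) \sum_a \sum_b
    mxvec (derive1n j h x) 0 a * C j k x a b * mxvec (derive1n k h x) 0 b.
Proof.
apply: eq_bigr => j _; apply: eq_bigr => k _; rewrite mxE exchange_big/=.
apply: eq_bigr => b _; rewrite mxE big_distrl/=; apply: eq_bigr => a _.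
by rewrite !mxE.
Qed.

Lemma quadratic_jet_form_eq q F F' : quadratic_jet_form q F ->
  (forall J h, admissible q J h -> {in J, F' h =1 F h}) -> quadratic_jet_form q F'.
Proof.
move=> [C [cC FC]] FF'; exists C; split=> // J h hJ x Jx.
by rewrite (FF' J) ?(FC J).
Qed.

Lemma quadratic_jet_formD q F F' :
  quadratic_jet_form q F -> quadratic_jet_form q F' ->
  quadratic_jet_form q (fun h x => F h x + F' h x).
Proof.
move=> [C [cC FC]] [D [cD FD]]; exists (fun j k x => C j k x + D j k x).
split=> [j k a b|J h hJ x Jx].
  by under eq_fun do rewrite mxE; exact: coefficientD.
rewrite (FC J)// (FD J)// -big_split/=; apply: eq_bigr => j _.
rewrite -big_split/=; apply: eq_bigr => k _.
by rewrite mulmxDr mulmxDl [RHS]mxE.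
Qed.

Lemma quadratic_jet_form0 q : quadratic_jet_form q (fun _ _ => 0).
Proof.
exists (fun _ _ _ => 0); split=> [j k a b|J h hJ x Jx].
  by under eq_fun do rewrite mxE; exact: coefficient_cst.
rewrite /quad_diff_form big1// => j _; rewrite big1// => k _.
by rewrite mulmx0 mul0mx mxE.
Qed.

Lemma quadratic_jet_form_sum q (I : Type) (s : seq I) F :
  (forall i, quadratic_jet_form q (F i)) ->
  quadratic_jet_form q (fun h x => \sum_(i <- s) F i h x).
Proof.
move=> qF; elim: s => [|i s IH].
  apply: quadratic_jet_form_eq (quadratic_jet_form0 q) _ => J h hJ x Jx.
  by rewrite big_nil.
apply: quadratic_jet_form_eq (quadratic_jet_formD (qF i) IH) _ => J h hJ x Jx.
by rewrite big_cons.
Qed.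

Lemma quadratic_jet_formZ q (w : R) F : quadratic_jet_form q F ->
  quadratic_jet_form q (fun h x => w * F h x).
Proof.
move=> [C [cC FC]]; exists (fun j k x => w *: C j k x); split=> [j k a b|J h hJ x Jx].
  by under eq_fun do rewrite mxE; apply: coefficientM => //; exact: coefficient_cst.
rewrite (FC J)// mulr_sumr; apply: eq_bigr => j _; rewrite mulr_sumr.
by apply: eq_bigr => k _; rewrite -scalemxAr -scalemxAl [RHS]mxE.
Qed.

Lemma quadratic_jet_formM q L L' : linear_jet_form q L -> linear_jet_form q L' ->
  quadratic_jet_form q (fun h x => L h x * L' h x).
Proof.
move=> [c [cc Lc]] [d [cd Ld]].
exists (fun j k x => \matrix_(a, b) (c j a x * d k b x)); split=> [j k a b|J h hJ x Jx].
  by under eq_fun do rewrite mxE; exact: coefficientM.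
rewrite (Lc J)// (Ld J)// quad_diff_formE big_distrl/=; apply: eq_bigr => j _.
rewrite big_distrr/=; apply: eq_bigr => k _.
rewrite big_distrl/=; apply: eq_bigr => a _; rewrite big_distrr/=.
by apply: eq_bigr => b _; rewrite mxE; ring.
Qed.

End Fixed.
End JetForms.

(** * Integration by parts *)

Section IntegrationByParts.
Context {R : realType}.
Implicit Types (J : set R) (f g : R -> R).

(** The boundary term of [k] integrations by parts: it accounts for moving [k]
    derivatives from [g] to [f]. *)
Definition parts_flux k f g x : R :=
  \sum_(j < k) (-1) ^+ j * (derive1n j f x * derive1n (k - j.+1) g x).

(** By the product rule the derivative of the j-th summand is a difference of
    consecutive terms, so the sum telescopes. *)
Lemma is_derive_parts_flux J k f g x :
  diff_times_on k J f -> diff_times_on k J g -> J x ->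
  derivable (parts_flux k f g) x 1 /\
  derive1 (parts_flux k f g) x =
    f x * derive1n k g x - (-1) ^+ k * (derive1n k f x * g x).
Proof.
move=> df dg Jx.
have dfj (j : 'I_k) : derivable (derive1n j f) x 1 by exact: df.
have dgj (j : 'I_k) : derivable (derive1n (k - j.+1) g) x 1.
  by apply: dg => //; rewrite subnSK ?leq_subr.
have dfg (j : 'I_k) : derivable (fun y => derive1n j f y * derive1n (k - j.+1) g y) x 1.
  exact: (derivableM (dfj j) (dgj j)).
split; first by apply: derivable_sum_fun => j; exact: derivableZl.
rewrite /parts_flux derive1_sum => [|j]; last exact: derivableZl.
pose T j := - ((-1) ^+ j * (derive1n j f x * derive1n (k - j) g x)).
transitivity (\sum_(0 <= j < k) (T j.+1 - T j)); last first.
  by rewrite telescope_sumr// /T subn0 subnn expr0 mul1r opprK addrC.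
rewrite big_mkord; apply: eq_bigr => j _.
rewrite derive1Zl// derive1M// /T -(subnSK (ltn_ord j)) !derive1nS exprS.
by ring.
Qed.

End IntegrationByParts.

(** * Polynomial jets *)

Section PolynomialJets.
Context {R : realType} {m p : nat}.

Lemma derive1n_horner_scale (P : {poly R}) (M : 'M[R]_(m, p)) k :
  derive1n k (fun y => P.[y] *: M) = (fun y => (derivn k P).[y] *: M) /\
  forall x, derivable (derive1n k (fun y => P.[y] *: M)) x 1.
Proof.
have dQ (Q : {poly R}) x i j : derivable (fun y => Q.[y] * M i j) x 1.
  have dh : derivable (horner Q) x 1 by exact: derivable_horner.
  by apply: (derivableM dh); exact: derivable_cst.
have dQM (Q : {poly R}) x : derivable (fun y => Q.[y] *: M) x 1.
  by apply/derivable_mxP => i j; under eq_fun do rewrite mxE; exact: dQ.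
suff E : derive1n k (fun y => P.[y] *: M) = (fun y => (derivn k P).[y] *: M).
  by rewrite E; split=> // x; exact: dQM.
elim: k => [//|k IH]; rewrite derive1nS IH; apply/funext => x.
apply/matrixP => i j; rewrite derive1_mx; last exact: dQM.
under eq_fun do rewrite mxE.
have dh : derivable (horner (derivn k P)) x 1 by exact: derivable_horner.
have := derive1M dh (derivable_cst (M i j) x 1).
by move=> ->; rewrite derive1_cst mulr0 addr0 -derivE mxE derivnS.
Qed.

Lemma derivn_shift (P : {poly R}) (c : R) k :
  ((P \Po ('X - c%:P))^`(k) = P^`(k) \Po ('X - c%:P))%R.
Proof.
by elim: k => [//|k IH]; rewrite derivnS IH deriv_comp derivXsubC mulr1 -derivnS.
Qed.

(** A linear jet form is determined by its values on polynomials, because these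
    realize every jet at a point: the derivative of order k of (y - x) ^ j at x
    is j! for k = j and 0 otherwise. *)
Lemma linear_jet_form_eq0 (X : set R) (B : Prop) q
    (L : (R -> 'M[R]_(m, p)) -> R -> R) :
  open X -> linear_jet_form X B q L ->
  (forall h, smooth_on X h -> forall x, X x -> L h x = 0) ->
  forall J h, admissible X q J h -> forall x, J x -> L h x = 0.
Proof.
move=> Xo [c [_ Lc]] L0.
have c0 x (j : 'I_q.+1) a : X x -> c j a x = 0.
  move=> Xx; pose P := ('X^j \Po ('X - x%:P) : {poly R})%R.
  pose h y := P.[y] *: vec_mx (delta_mx 0 a) : 'M[R]_(m, p).
  have dh k : diff_times_on k X h.
    move=> l _ y _.
    by have [_] := derive1n_horner_scale P (vec_mx (delta_mx 0 a)) l; apply.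
  have hX : admissible X q X h by split.
  have : L h x = 0 by apply: L0 => //; exact/smooth_on1P.
  rewrite (Lc _ _ hX) ?inE//.
  have hE k b : mxvec (derive1n k h x) 0 b = ((k == j) && (b == a))%:R *+ k`!.
    have [-> _] := derive1n_horner_scale P (vec_mx (delta_mx 0 a)) k.
    rewrite linearZ/= vec_mxK !mxE eqxx derivn_shift horner_comp !hornerE subrr.
    rewrite horner_coef0 coef_derivn addn0 coefXn ffactnn.
    by case: (k == j); case: (b == a); rewrite ?mulr1 ?mulr0 ?mul0rn.
  rewrite (bigD1 j)//= [X in _ + X]big1 => [|k kj]; last first.
    by rewrite big1// => b _; rewrite hE val_eqE (negPf kj) mul0rn mulr0.
  rewrite addr0 (bigD1 a)//= [X in _ + X]big1 => [|b ba]; last first.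
    by rewrite hE (negPf ba) andbF mul0rn mulr0.
  rewrite addr0 hE !eqxx/= => /eqP; rewrite mulf_eq0 pnatr_eq0.
  by rewrite eqn0Ngt fact_gt0 orbF => /eqP.
move=> J h hJ x Jx; rewrite (Lc J)// ?inE//.
have [_ JX _] := hJ.
by rewrite big1// => j _; rewrite big1// => a _; rewrite c0 ?mul0r//; exact: JX.
Qed.

End PolynomialJets.

(** * The energy flux *)

Section Core.
Context {R : realType} (X : set R) (Xo : open X).
Context {n N r : nat} (K : 'I_r.+1 -> R -> 'M[R]_n).
Hypothesis K_smooth : forall k, smooth_on X (K k).
Hypothesis K_skew : skew_adjoint_on X K.

Let B := forall k, constant_on X (K k).

Lemma coefficient_K k i l : coefficient X B (fun x => K k x i l).
Proof.
split=> [s|cK x y Xx Xy]; last by rewrite (cK k x y).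
have : diff_times_on s X (K k) by move: s; exact/smooth_on1P.
by move=> /(diff_times_on_mx _ _ Xo).
Qed.

(** The components of [diffop_adj K a] and [diffop K a] in terms of the scalar
    components of [a].  The two descriptions agree for functions that are
    differentiable often enough ([diffop_adjE], [diffopE]). *)
Definition adjoint_entry (a : 'I_n -> R -> R) l x : R :=
  \sum_(k < r.+1) \sum_i (-1) ^+ k * derive1n k (fun y => K k y i l * a i y) x.

Definition operator_entry (a : 'I_n -> R -> R) i x : R :=
  \sum_(k < r.+1) \sum_l K k x i l * derive1n k (a l) x.

Lemma diffopE J (a : R -> 'cV[R]_n) i : open J -> diff_times_on r J a ->
  {in J, (fun x => diffop K a x i 0) =1 operator_entry (fun l y => a y l 0) i}.
Proof.
move=> Jo da x Jx; rewrite /diffop summxE; apply: eq_bigr => k _.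
rewrite mxE; apply: eq_bigr => l _.
by rewrite (derive1n_mx l 0 Jo da)// -ltnS.
Qed.

Lemma diffop_adjE (a : R -> 'cV[R]_n) l : diff_times_on r X a ->
  {in X, (fun x => diffop_adj K a x l 0) =1 adjoint_entry (fun i y => a y i 0) l}.
Proof.
move=> da x Jx; rewrite /diffop_adj summxE; apply: eq_bigr => k _.
have da' i : diff_times_on r X (fun y => a y i 0).
  by have /(diff_times_on_mx _ _ Xo) := da.
have dK i l' : diff_times_on r X (fun y => K k y i l').
  by have [+ _] := coefficient_K k i l'.
have dM l' : diff_times_on r X (fun y => \sum_i K k y i l' * a y i 0).
  apply: diff_times_on_sum => [|i]; first exact: Xo.
  exact: (diff_times_onM Xo (dK i l') (da' i)).
have KaE l' : (fun y => ((K k y)^T *m a y) l' 0) =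
    fun y => \sum_i K k y i l' * a y i 0.
  by apply/funext => y; rewrite mxE; apply: eq_bigr => i _; rewrite mxE.
have dKa : diff_times_on r X (fun y => (K k y)^T *m a y).
  apply/(diff_times_on_mx _ _ Xo) => l' j; rewrite ord1 KaE.
  exact: dM.
have kr : (k <= r)%N by rewrite -ltnS.
have := derive1n_mx l 0 Xo dKa kr Jx; rewrite mxE => ->.
rewrite -mulr_sumr; congr (_ * _).
rewrite KaE; rewrite inE in Jx.
elim: (k : nat) x Jx kr => [//|s IH] x Jx sr.
have dKas i : derivable (derive1n s (fun y => K k y i l * a y i 0)) x 1.
  by apply: (diff_times_onM Xo (dK i l) (da' i)).
under eq_bigr do rewrite derive1nS.
rewrite derive1nS -derive1_sum//.
apply: (derive1_eq_on Xo); last by rewrite inE.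
by move=> y; rewrite inE => Xy; apply: IH => //; exact: ltnW.
Qed.

(** Skew-adjointness is assumed for smooth arguments.  It extends to arguments
    that are only [r] times differentiable because both sides are linear jet
    forms of order [r], which are determined by their values on polynomials. *)
Lemma skew_entries J (e : 'I_n -> R -> R) l : open J -> J `<=` X ->
  (forall i, diff_times_on r J (e i)) ->
  forall x, J x -> adjoint_entry e l x = - operator_entry e l x.
Proof.
move=> Jo JX de x Jx; apply/eqP; rewrite -subr_eq0 opprK; apply/eqP.
pose a (y : R) : 'cV[R]_n := \col_i e i y.
have aE : (fun i y => a y i 0) = e.
  by apply/funext => i; apply/funext => y; rewrite mxE.
rewrite -{}aE; pose S := fun (a : R -> 'cV[R]_n) x =>
  adjoint_entry (fun i y => a y i 0) l x + operator_entry (fun i y => a y i 0) l x.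
rewrite -[LHS]/(S a x).
apply: (@linear_jet_form_eq0 _ _ _ X B r S Xo _ _ J) => //.
- apply: linear_jet_formD => //.
  + apply: linear_jet_form_sum => // k; apply: linear_jet_form_sum => // i.
    apply: linear_jet_formM => //; first exact: coefficient_cst.
    have := @linear_jet_form_derive1n _ X B Xo n 1 0 k.
    move=> /(_ (fun a y => K k y i l * a y i 0)) H.
    apply: linear_jet_form_leq (H _) => //; first by rewrite add0n -ltnS.
    apply: linear_jet_formM => //; first exact: coefficient_K.
    exact: linear_jet_form_coord.
  + apply: linear_jet_form_sum => // k; apply: linear_jet_form_sum => // i.
    apply: linear_jet_formM => //; first exact: coefficient_K.
    have := @linear_jet_form_derive1n _ X B Xo n 1 0 k.
    move=> /(_ (fun a y => a y i 0) (linear_jet_form_coord X B i 0)) H.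
    by apply: linear_jet_form_leq H => //; rewrite add0n -ltnS.
- move=> b sb y Xy; rewrite /S.
  have db : diff_times_on r X b by apply: (smooth_on1P b Xo).1.
  have Xy' : y \in X by rewrite inE.
  rewrite -(diffop_adjE l db Xy') -(diffopE l Xo db Xy').
  by rewrite K_skew// mxE addNr.
- split=> //; apply/(diff_times_on_mx _ _ Jo) => i j.
  by under eq_fun do rewrite mxE; exact: de.
Qed.


Lemma quadratic_parts_flux m p q q1 q2 k
    (L L' : (R -> 'M[R]_(m, p)) -> R -> R) :
  linear_jet_form X B q1 L -> linear_jet_form X B q2 L' ->
  (q1 + k <= q.+1)%N -> (q2 + k <= q.+1)%N ->
  quadratic_jet_form X B q (fun h => parts_flux k (L h) (L' h)).
Proof.
move=> lL lL' q1k q2k; apply: quadratic_jet_form_sum => // j.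
apply: quadratic_jet_formZ => //.
have jk := ltn_ord j.
apply: quadratic_jet_formM => //.
  by apply: linear_jet_form_leq (linear_jet_form_derive1n Xo j lL); lia.
by apply: linear_jet_form_leq (linear_jet_form_derive1n Xo (k - j.+1) lL'); lia.
Qed.

Definition euler_entry i (h : R -> 'M[R]_(n, N.+1)) x : R :=
  \sum_(k < N.+1) (-1) ^+ k * derive1n k (fun y => h y i k) x.

Definition source_entry i (h : R -> 'M[R]_(n, N.+1)) : R -> R :=
  operator_entry (fun l => euler_entry l h) i.

Lemma linear_euler_entry i : linear_jet_form X B N (euler_entry i).
Proof.
apply: linear_jet_form_sum => // k; apply: linear_jet_formM => //.
  exact: coefficient_cst.
have H := linear_jet_form_derive1n Xo k (linear_jet_form_coord X B i k).
by apply: linear_jet_form_leq H; rewrite add0n -ltnS.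
Qed.

Lemma linear_source_entry i : linear_jet_form X B (N + r) (source_entry i).
Proof.
apply: linear_jet_form_sum => // k; apply: linear_jet_form_sum => // l.
apply: linear_jet_formM => //; first exact: coefficient_K.
have H := linear_jet_form_derive1n Xo k (linear_euler_entry l).
by apply: linear_jet_form_leq H; rewrite leq_add2l -ltnS.
Qed.

Lemma eulerE J (h : R -> 'M[R]_(n, N.+1)) i : open J -> diff_times_on N J h ->
  {in J, (fun x => euler h x i 0) =1 euler_entry i h}.
Proof.
move=> Jo dh x Jx; rewrite /euler summxE; apply: eq_bigr => k _.
have dk : diff_times_on N J (fun y => col k (h y)).
  apply/(diff_times_on_mx _ _ Jo) => i' j; under eq_fun do rewrite mxE.
  exact: (diff_times_on_mx _ _ Jo).1 dh i' k.
have kN : (k <= N)%N by rewrite -ltnS.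
have := derive1n_mx i 0 Jo dk kN Jx; rewrite mxE => ->.
by under eq_fun do rewrite mxE.
Qed.

Lemma diffop_eulerE J (h : R -> 'M[R]_(n, N.+1)) i : admissible X (N + r) J h ->
  {in J, (fun x => diffop K (euler h) x i 0) =1 source_entry i h}.
Proof.
move=> hJ; have [Jo JX dh] := hJ.
have dhN := diff_times_on_leq (leq_addr r N) dh.
have de : diff_times_on r J (euler h).
  apply/(diff_times_on_mx _ _ Jo) => l j; rewrite ord1.
  apply: (diff_times_on_eq Jo (f := euler_entry l h)).
    by move=> x Jx; have /= -> := eulerE l Jo dhN Jx.
  exact: (linear_jet_form_diff (linear_euler_entry l) hJ).
move=> x Jx; have /= -> := diffopE i Jo de Jx.
apply: eq_bigr => k _; apply: eq_bigr => l _; congr (_ * _).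
by apply: (derive1n_eq_on _ Jo) => //; exact: eulerE.
Qed.

(** Boundary terms of the two integrations by parts.  The factor 2^-1 is there
    because the second one yields twice the product of E(h) and K E(h). *)
Definition flux (h : R -> 'M[R]_(n, N.+1)) x : R :=
  (-1) * (\sum_i \sum_(k < N.+1) parts_flux k (fun y => h y i k) (source_entry i h) x
  + 2^-1 * \sum_(k < r.+1) \sum_l \sum_i
      parts_flux k (fun y => K k y i l * euler_entry i h y) (euler_entry l h) x).

Lemma quadratic_flux : quadratic_jet_form X B (N + r + N) flux.
Proof.
apply: quadratic_jet_formZ => //; apply: quadratic_jet_formD => //.
  apply: quadratic_jet_form_sum => // i; apply: quadratic_jet_form_sum => // k.
  have kN := ltn_ord k.
  apply: (quadratic_parts_flux (q1 := 0%N) (q2 := (N + r)%N)); [| |lia|lia].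
    exact: linear_jet_form_coord.
  exact: linear_source_entry.
apply: quadratic_jet_formZ => //.
apply: quadratic_jet_form_sum => // k; apply: quadratic_jet_form_sum => // l.
apply: quadratic_jet_form_sum => // i; have kr := ltn_ord k.
apply: (quadratic_parts_flux (q1 := N) (q2 := N)); [| |lia|lia].
  by apply: linear_jet_formM => //; [exact: coefficient_K|exact: linear_euler_entry].
exact: linear_euler_entry.
Qed.

(** The first sum in [flux] has as derivative the wanted sum minus the
    product [EW] of E(h) and K E(h).  The second has [EW] minus the product of
    E(h) and K^* E(h), which is twice [EW] by skew-adjointness. *)
Lemma flux_balance J h x : admissible X (N + r + N) J h -> J x ->
  derivable (flux h) x 1 /\
  derive1 (flux h) x =
    - \sum_i \sum_(k < N.+1) h x i k * derive1n k (source_entry i h) x.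
Proof.
move=> hJ Jx; have [Jo JX dh] := hJ.
have dE s i : (s <= r)%N -> diff_times_on s J (euler_entry i h).
  move=> sr; apply: (linear_jet_form_diff (linear_euler_entry i)).
  by apply: admissible_leq hJ; lia.
have dKE s k i l : (s <= r)%N ->
    diff_times_on s J (fun y => K k y i l * euler_entry i h y).
  move=> sr; apply: (diff_times_onM Jo); last exact: dE.
  by apply: diff_times_on_subset JX _; have [+ _] := coefficient_K k i l; apply.
have dW s i : (s <= N)%N -> diff_times_on s J (source_entry i h).
  move=> sN; apply: (linear_jet_form_diff (linear_source_entry i)).
  by apply: admissible_leq hJ; lia.
have dhe s i k : (s <= N)%N -> diff_times_on s J (fun y => h y i k).
  move=> sN; have /(diff_times_on_mx _ _ Jo) := dh => /(_ i k).
  by apply: diff_times_on_leq; lia.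
have parts1 i (k : 'I_N.+1) := is_derive_parts_flux
  (dhe k i k (ltn_ord k)) (dW k i (ltn_ord k)) Jx.
have parts2 (k : 'I_r.+1) i l := is_derive_parts_flux
  (dKE k k i l (ltn_ord k)) (dE k l (ltn_ord k)) Jx.
have der1i i : derivable (fun y => \sum_(k < N.+1)
    parts_flux k (fun y => h y i k) (source_entry i h) y) x 1.
  by apply: derivable_sum_fun => k; exact: (parts1 i k).1.
have der2kl (k : 'I_r.+1) l : derivable (fun y => \sum_i
    parts_flux k (fun y => K k y i l * euler_entry i h y) (euler_entry l h) y) x 1.
  by apply: derivable_sum_fun => i; exact: (parts2 k i l).1.
have der2k (k : 'I_r.+1) : derivable (fun y => \sum_l \sum_i
    parts_flux k (fun y => K k y i l * euler_entry i h y) (euler_entry l h) y) x 1.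
  by apply: derivable_sum_fun => l; exact: der2kl.
have der1 := derivable_sum_fun (s := index_enum _) der1i.
have der2 := derivable_sum_fun (s := index_enum _) der2k.
have der2' := derivableZl (c := 2^-1) der2.
have der12 := derivableD der1 der2'.
split; first exact: (derivableZl (c := -1) der12).
rewrite [LHS](derive1Zl (-1) der12) (derive1D der1 der2') (derive1Zl 2^-1 der2).
rewrite (derive1_sum _ der1i) (derive1_sum _ der2k).
set Wd := (X in _ * (X + _)); set W2 := (X in _ * (_ + _ * X)).
pose EW := \sum_i euler_entry i h x * source_entry i h x.
have -> : Wd = \sum_i \sum_(k < N.+1) h x i k * derive1n k (source_entry i h) x - EW.
  rewrite /Wd /EW -sumrB; apply: eq_bigr => i _.
  rewrite [LHS]/= derive1_sum => [|k]; last exact: (parts1 i k).1.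
  rewrite /euler_entry big_distrl/= -sumrB; apply: eq_bigr => k _.
  by rewrite (parts1 i k).2 mulrA.
have -> : W2 = 2 * EW.
  have -> : 2 * EW = EW - \sum_l
      adjoint_entry (fun i => euler_entry i h) l x * euler_entry l h x.
    rewrite mulr_natl mulr2n; congr (_ + _); rewrite -sumrN; apply: eq_bigr => l _.
    have dEr i : diff_times_on r J (euler_entry i h) by exact: dE.
    by rewrite (skew_entries l Jo JX dEr Jx) mulNr opprK mulrC.
  rewrite /W2 /EW /source_entry /operator_entry /adjoint_entry.
  under [X in _ = X - _]eq_bigr do rewrite mulr_sumr.
  under [X in _ = _ - X]eq_bigr do rewrite mulr_suml.
  rewrite [X in _ = X - _]exchange_big [X in _ = _ - X]exchange_big -sumrB/=.
  apply: eq_bigr => k _; rewrite [LHS]/= derive1_sum => [|l]; last exact: der2kl.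
  under [X in _ = X - _]eq_bigr do rewrite mulr_sumr.
  rewrite [X in _ = X - _]exchange_big -sumrB/=; apply: eq_bigr => l _.
  rewrite derive1_sum => [|i]; last exact: (parts2 k i l).1.
  rewrite mulr_suml -sumrB; apply: eq_bigr => i _.
  by rewrite (parts2 k i l).2; ring.
by field.
Qed.

(** This holds for all functions [h], so that gradients and discrete gradients
    can be treated alike.  The boundary terms contain at most [N - 1]
    derivatives of K E(h), which has order [N + r] in [h], so they are defined
    and differentiable if [h] is [N + r + N] times differentiable. *)
Lemma energy_flux : exists C : 'I_(N + r + N).+1 -> 'I_(N + r + N).+1 -> R ->
    'M[R]_(n * N.+1),
  [/\ (forall j k, smooth_on X (C j k)),
      (forall k, constant_on X (K k)) -> forall j k, constant_on X (C j k) &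
      forall J h x, admissible X (N + r + N) J h -> J x ->
        derivable (quad_diff_form C h) x 1 /\
        derive1 (quad_diff_form C h) x = - \sum_i \sum_(k < N.+1)
          h x i k * derive1n k (fun y => diffop K (euler h) y i 0) x].
Proof.
have [C [cC FC]] := quadratic_flux.
exists C; split=> [j k|cK j k x y Xx Xy|J h x hJ Jx].
- apply/(smooth_on1P _ Xo) => s; apply/(diff_times_on_mx _ _ Xo) => a b.
  by have [+ _] := cC j k a b; apply.
- by apply/matrixP => a b; have [_ /(_ cK)] := cC j k a b; exact.
have [Jo _ _] := hJ; have [dF eF] := flux_balance hJ Jx.
have FCJ := FC J h hJ.
split; first exact: (derivable_eq_on Jo Jx FCJ).
have Jx' : x \in J by rewrite inE.
rewrite -(derive1_eq_on Jo FCJ Jx') eF; congr (- _).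
apply: eq_bigr => i _; apply: eq_bigr => k _; congr (_ * _).
apply/esym/(derive1n_eq_on _ Jo) => //; apply: diffop_eulerE.
by apply: admissible_leq hJ; lia.
Qed.

End Core.

(** * Smooth functions of several variables *)

Section SeveralVariables.
Context {R : realType}.

Lemma near_eq_differentiable {E W : normedModType R} (f g : E -> W) x :
  (\near x, f x = g x) -> differentiable f x -> differentiable g x.
Proof.
move=> fg df.
have gE : g \o shift x = cst (g x) + 'd f x +o_ 0 id.
  apply/eqaddoP => e e0; have /eqaddoP/(_ e e0) := diff_locally df.
  apply: filterS2; last first.
    have := fg; rewrite (near_shift 0) subr0; exact.
  by move=> h /= fgh; rewrite !fctE/= -(nbhs_singleton fg) fgh.
have dg := diff_unique (diff_continuous df) gE.
by apply/diff_locallyP; rewrite dg; split=> //; exact: diff_continuous.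
Qed.

Section Domain.
Context {E : normedModType R} (U : set E) (Uo : open U).

Lemma smooth_on_differentiable {W : normedModType R} (f : E -> W) x :
  smooth_on U f -> U x -> differentiable f x.
Proof. by move=> sf; exact: (sf [::]). Qed.

Lemma smooth_on_derive {W : normedModType R} (f : E -> W) v :
  smooth_on U f -> smooth_on U ('D_v f).
Proof. by move=> sf vs x Ux; have := sf (rcons vs v) x Ux; rewrite foldr_rcons. Qed.

Lemma smooth_on_iter {W : normedModType R} (f : E -> W) v k :
  smooth_on U f -> smooth_on U (iter k (fun g => 'D_v g) f).
Proof. by move=> sf; elim: k => //= k; exact: smooth_on_derive. Qed.

Lemma smooth_on_entry {m p} (M : E -> 'M[R]_(m, p)) i j :
  smooth_on U M -> smooth_on U (fun x => M x i j).
Proof.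
move=> sM vs x Ux.
have ME : {in U,
    (fun y => foldr (fun v (g : E -> 'M[R]_(m, p)) => 'D_v g) M vs y i j)
    =1 foldr (fun v (g : E -> R) => 'D_v g) (fun y => M y i j) vs}.
  elim: vs {x Ux} => [//|v vs IH] y; rewrite inE => Uy /=.
  rewrite derive_mx ?mxE; last exact/diff_derivable/sM.
  exact: near_eq_derive (open_near_eq Uo Uy IH).
apply: (near_eq_differentiable (open_near_eq Uo Ux ME)).
have dc N := @differentiable_coord R m p N i j.
exact: (differentiable_comp (sM vs x Ux) (dc _)).
Qed.

(** * Symmetry of second derivatives *)

Lemma is_derive_line (g : E -> R) p u (s : R) : differentiable g (p + s *: u) ->
  is_derive s 1 (fun s => g (p + s *: u)) ('D_u g (p + s *: u)).
Proof.
move=> dg; have dgu : derivable g (p + s *: u) u by exact: diff_derivable.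
have E0 : (fun h => h^-1 *:
      (((fun s : R => g (p + s *: u)) \o shift s) (h *: 1) - g (p + s *: u))) =
    (fun h => h^-1 *: ((g \o shift (p + s *: u)) (h *: u) - g (p + s *: u))).
  apply/funext => h /=; congr (_ *: (g _ - _)).
  by rewrite scalerDl [h *: 1]mulr1 addrCA.
by apply: DeriveDef; rewrite /derivable /derive E0.
Qed.

Lemma MVT_line (g : E -> R) p u (h : R) : 0 < h ->
  (forall s, 0 <= s <= h -> differentiable g (p + s *: u)) ->
  exists2 s, 0 <= s <= h & g (p + h *: u) - g p = 'D_u g (p + s *: u) * h.
Proof.
move=> h0 dg.
have [||s sh] := @MVT R (fun s => g (p + s *: u)) (fun s => 'D_u g (p + s *: u)) 0 h h0.
- move=> s; rewrite in_itv/= => /andP[s0 sh]; apply: is_derive_line; apply: dg.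
  by rewrite !ltW.
- apply: derivable_within_continuous => s; rewrite in_itv/= => sh.
  by have [] := is_derive_line (dg s sh).
rewrite scale0r addr0 subr0 => gE; exists s => //.
by move: sh; rewrite in_itv/= => /andP[s0 sh]; rewrite !ltW.
Qed.

(** The mean value theorem is used first along [u], for the increment of [f]
    along [v], and then along [v], for the derivative of [f] along [u]. *)
Lemma second_difference (f : E -> R) x u v (h : R) : smooth_on U f -> 0 < h ->
  (forall s t, 0 <= s <= h -> 0 <= t <= h -> U (x + s *: u + t *: v)) ->
  exists s t, [/\ 0 <= s <= h, 0 <= t <= h &
    f (x + h *: u + h *: v) - f (x + h *: u) - (f (x + h *: v) - f x) =
    'D_v ('D_u f) (x + s *: u + t *: v) * h * h].
Proof.
move=> sf h0 hU.
have hh : 0 <= h <= h by rewrite lexx ltW.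
have h00 : 0 <= (0 : R) <= h by rewrite lexx ltW.
pose g y := f (y + h *: v) - f y.
have dfs y : U y -> differentiable f y by exact: smooth_on_differentiable.
have dg s : 0 <= s <= h -> is_derive s 1 (fun s => g (x + s *: u))
    ('D_u f (x + s *: u + h *: v) - 'D_u f (x + s *: u)).
  move=> sh; rewrite /g; apply: is_deriveB.
    under eq_fun do rewrite addrAC.
    rewrite addrAC; apply: is_derive_line; rewrite addrAC; apply: dfs; exact: hU.
  apply: is_derive_line; apply: dfs.
  by have := hU s 0 sh h00; rewrite scale0r addr0.
have [||s sh gE] := @MVT R (fun s => g (x + s *: u)) (fun s =>
    'D_u f (x + s *: u + h *: v) - 'D_u f (x + s *: u)) 0 h h0.
- move=> s; rewrite in_itv/= => /andP[s0 sh]; apply: dg.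
  by rewrite !ltW.
- apply: derivable_within_continuous => s; rewrite in_itv/= => sh.
  by have [] := dg s sh.
have {}sh : 0 <= s <= h.
  by move: sh; rewrite in_itv/= => /andP[s0 sh]; rewrite !ltW.
have [|t th tE] := @MVT_line ('D_u f) (x + s *: u) v h h0.
  move=> t th; apply: (smooth_on_differentiable (smooth_on_derive u sf)); exact: hU.
exists s, t; split=> //.
move: gE; rewrite scale0r addr0 subr0 /g => ->.
by rewrite tE.
Qed.

(** The second difference is symmetric in [u] and [v], so on small
    parallelograms both second derivatives take a common value, at different
    points near [x].  Continuity of both at [x] makes them equal there. *)
Lemma derive_commute (f : E -> R) u v x : smooth_on U f -> U x ->
  'D_u ('D_v f) x = 'D_v ('D_u f) x.
Proof.
move=> sf Ux.
have near_D w1 w2 (e : R) : 0 < e ->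
    \forall y \near x, `|'D_w1 ('D_w2 f) x - 'D_w1 ('D_w2 f) y| < e.
  have sD := smooth_on_derive w1 (smooth_on_derive w2 sf).
  have := differentiable_continuous (smooth_on_differentiable sD Ux).
  by move=> /cvgrPdist_lt; exact.
apply/eqP; rewrite -subr_eq0 -normr_le0; apply/ler_addgt0Pl => e e0; rewrite addr0.
have e20 : 0 < e / 2 by rewrite divr_gt0.
have /nbhs_ballP[d /= d0 dU] : \forall y \near x, [/\ U y,
    `|'D_u ('D_v f) x - 'D_u ('D_v f) y| < e / 2 &
    `|'D_v ('D_u f) x - 'D_v ('D_u f) y| < e / 2].
  apply: filterS3 (near_D u v _ e20) (near_D v u _ e20) (open_nbhs_nbhs (conj Uo Ux)).
  by move=> y.
(* With this step the whole parallelogram lies in the ball of radius d. *)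
pose h := d / 2 / (`|u| + `|v| + 1).
have uv0 : 0 < `|u| + `|v| + 1 by rewrite ltr_wpDl// addr_ge0.
have h0 : 0 < h by rewrite !divr_gt0.
have hd s t : 0 <= s <= h -> 0 <= t <= h -> ball x d (x + s *: u + t *: v).
  move=> /andP[s0 sh] /andP[t0 th].
  rewrite -ball_normE/= -addrA opprD addrA subrr sub0r normrN.
  rewrite (le_lt_trans (ler_normD _ _))// !normrZ !ger0_norm//.
  apply: (@le_lt_trans _ _ (h * (`|u| + `|v|))).
    by rewrite mulrDr lerD// ler_wpM2r.
  apply: (@lt_trans _ _ (h * (`|u| + `|v| + 1))).
    by rewrite ltr_pM2l// ltrDl.
  by rewrite /h divfK ?gt_eqF// ltr_pdivrMr// ltr_pMr// ltr1n.
have hd' s t : 0 <= s <= h -> 0 <= t <= h -> ball x d (x + s *: v + t *: u).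
  by move=> sh th; rewrite addrAC; exact: hd.
have [|s [t [sh th E1]]] := @second_difference f x u v h sf h0.
  by move=> s t sh th; have [] := dU _ (hd _ _ sh th).
have [|s' [t' [sh' th' E2]]] := @second_difference f x v u h sf h0.
  by move=> s' t' sh' th'; have [] := dU _ (hd' _ _ sh' th').
have [_ _ A1] := dU _ (hd _ _ sh th).
have [_ A2 _] := dU _ (hd' _ _ sh' th').
have E3 : 'D_v ('D_u f) (x + s *: u + t *: v) = 'D_u ('D_v f) (x + s' *: v + t' *: u).
  have hn : h != 0 by rewrite gt_eqF.
  (* Both sides are the second difference over the parallelogram of side h. *)
  suff : 'D_v ('D_u f) (x + s *: u + t *: v) * h * h =
      'D_u ('D_v f) (x + s' *: v + t' *: u) * h * h by move=> /(mulIf hn) /(mulIf hn).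
  apply: etrans (esym E1) (etrans _ E2); rewrite (addrAC x (h *: v) (h *: u)).
  by move: (f _) (f _) (f _) (f _) => a b c a'; ring.
move: A1 A2; rewrite {}E3.
move: ('D_u ('D_v f) (x + _ + _)) ('D_u ('D_v f) x) ('D_v ('D_u f) x) => c a b A1 A2.
rewrite (_ : a - b = (a - c) - (b - c)); last by ring.
by rewrite (le_trans (ler_normB _ _))// (splitr e) lerD// ltW.
Qed.

Lemma derive_iter_commute (f : E -> R) u v k : smooth_on U f ->
  {in U, iter k (fun g => 'D_u g) ('D_v f) =1 'D_v (iter k (fun g => 'D_u g) f)}.
Proof.
move=> sf; elim: k => [//|k IH] x; rewrite inE => Ux /=.
rewrite (near_eq_derive _ (open_near_eq Uo Ux IH)).
by apply: derive_commute => //; exact: smooth_on_iter.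
Qed.

End Domain.
End SeveralVariables.

(** * Partial derivatives and the chain rule *)

Section PartialDerivatives.
Context {R : realType}.

Lemma derive_fst {V W : normedModType R} (G : R * V -> W) x v :
  'D_((1 : R), (0 : V)) G (x, v) = derive1 (fun y => G (y, v)) x.
Proof.
rewrite derive1E /derive.
have -> // : (fun h => h^-1 *:
    ((G \o shift (x, v)) (h *: ((1 : R), (0 : V))) - G (x, v))) =
  (fun h : R => h^-1 *: (((fun y => G (y, v)) \o shift x) (h *: 1) - G (x, v))).
apply/funext => h /=; congr (_ *: (G _ - _)).
by rewrite -[LHS]/(h *: 1 + x, h *: 0 + v) scaler0 add0r.
Qed.

Lemma derive_snd {V W : normedModType R} (G : R * V -> W) x v w :
  'D_((0 : R), w) G (x, v) = 'D_w (fun u => G (x, u)) v.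
Proof.
rewrite /derive.
have -> // : (fun h => h^-1 *:
    ((G \o shift (x, v)) (h *: ((0 : R), w)) - G (x, v))) =
  (fun h : R => h^-1 *: (((fun u => G (x, u)) \o shift v) (h *: w) - G (x, v))).
apply/funext => h /=; congr (_ *: (G _ - _)).
by rewrite -[LHS]/(h *: 0 + x, h *: w + v) scaler0 add0r.
Qed.

Lemma iter_derive_fst {V W : normedModType R} (G : R * V -> W) k x v :
  iter k (fun g => 'D_((1 : R), (0 : V)) g) G (x, v) =
  derive1n k (fun y => G (y, v)) x.
Proof.
elim: k x => [//|k IH] x; rewrite derive1nS /= derive_fst; congr (derive1 _ x).
by apply/funext => y; rewrite IH.
Qed.

Lemma foldr_derive_snd {V W : normedModType R} (G : R * V -> W) vs x v :
  foldr (fun w (g : V -> W) => 'D_w g) (fun u => G (x, u)) vs v =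
  foldr (fun w (g : R * V -> W) => 'D_w g) G [seq ((0 : R), w) | w <- vs] (x, v).
Proof.
elim: vs v => [//|w vs IH] v /=; rewrite derive_snd; congr ('D_w _ v).
by apply/funext => u; rewrite IH.
Qed.

Lemma differentiable_inr {V : normedModType R} (x : R) (v : V) :
  differentiable (fun u : V => (x, u)) v.
Proof. by apply: differentiable_pair. Qed.

Lemma smooth_slice {V W : normedModType R} (X : set R) (G : R * V -> W) x :
  smooth_on (X `*` setT) G -> X x -> smooth_on setT (fun u => G (x, u)).
Proof.
move=> sG Xx vs v _.
have -> : foldr (fun w (g : V -> W) => 'D_w g) (fun u => G (x, u)) vs =
    foldr (fun w (g : R * V -> W) => 'D_w g) G [seq ((0 : R), w) | w <- vs] \o
    (fun u => (x, u)).
  by apply/funext => u; exact: foldr_derive_snd.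
apply: differentiable_comp; first exact: differentiable_inr.
exact: sG.
Qed.

Lemma diff_mx_entries {m p} (g : 'M[R]_(m, p) -> R) v (M : 'M[R]_(m, p)) :
  differentiable g v ->
  'd g v M = \sum_i \sum_k M i k * 'D_(delta_mx i k) g v.
Proof.
move=> dg; rewrite {1}[M]matrix_sum_delta linear_sum; apply: eq_bigr => i _.
rewrite linear_sum; apply: eq_bigr => k _.
by rewrite linearZ deriveE.
Qed.

Lemma diff_comp_curve {V W : normedModType R} (g : V -> W) (c : R -> V) y :
  differentiable g (c y) -> derivable c y 1 ->
  derivable (fun s => g (c s)) y 1 /\
  derive1 (fun s => g (c s)) y = 'd g (c y) (derive1 c y).
Proof.
move=> dg /derivable1_diffP dc.
have dgc : differentiable (fun s => g (c s)) y by exact: (differentiable_comp dc dg).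
split; first exact/derivable1_diffP.
rewrite !derive1E'//.
have /= -> := diff_comp dc dg.
by [].
Qed.

Lemma chain_curve {m p} (G : R * 'M[R]_(m, p) -> R) (V : R -> 'M[R]_(m, p)) y :
  differentiable G (y, V y) -> derivable V y 1 ->
  derivable (fun s => G (s, V s)) y 1 /\
  derive1 (fun s => G (s, V s)) y = 'D_((1 : R), (0 : 'M[R]_(m, p))) G (y, V y) +
    \sum_i \sum_k derive1 V y i k * 'D_((0 : R), delta_mx i k) G (y, V y).
Proof.
move=> dG dV; have dV' := (derivable1_diffP _ _).1 dV.
have dc : differentiable (fun s : R => (s, V s)) y by exact: differentiable_pair.
have [dGc ->] := diff_comp_curve dG ((derivable1_diffP _ _).2 dc).
split=> //.
have -> : derive1 (fun s : R => (s, V s)) y = ((1 : R), derive1 V y).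
  rewrite !derive1E'//.
  have dI : differentiable (fun s : R => s) y by [].
  have /= -> := diff_pair dI dV'.
  by congr (_, _); rewrite -(derive1E' dI) derive1E derive_id.
have -> : ((1 : R), derive1 V y) =
    ((1 : R), (0 : 'M[R]_(m, p))) + ((0 : R), derive1 V y).
  by congr (_, _); rewrite ?addr0 ?add0r.
rewrite linearD deriveE//; congr (_ + _).
have dGs : differentiable (fun u => G (y, u)) (V y).
  by apply: (differentiable_comp (differentiable_inr y (V y))).
transitivity ('d (fun u => G (y, u)) (V y) (derive1 V y)).
  by rewrite -!deriveE// derive_snd.
rewrite diff_mx_entries//; apply: eq_bigr => i _; apply: eq_bigr => k _.
by rewrite derive_snd.
Qed.

(** By the chain rule the derivative of the composite is a sum of products of
    derivatives of the curve with composites of the same kind, so the induction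
    on the order runs over all smooth outer functions at once. *)
Lemma diff_times_on_comp {m p} (U : set (R * 'M[R]_(m, p))) J
    (V : R -> 'M[R]_(m, p)) : open J -> (forall k, diff_times_on k J V) ->
  (forall y, J y -> U (y, V y)) ->
  forall k (G : R * 'M[R]_(m, p) -> R), smooth_on U G ->
  diff_times_on k J (fun y => G (y, V y)).
Proof.
move=> Jo dV JU; elim=> [|k IH] G sG; first by move=> j; rewrite ltn0.
have cG y (Jy : J y) := chain_curve
  (smooth_on_differentiable sG (JU y Jy)) (dV 1%N 0%N isT y Jy).
apply/diff_times_onS; split=> [y Jy|]; first exact: (cG y Jy).1.
pose F y := 'D_((1 : R), (0 : 'M[R]_(m, p))) G (y, V y) +
    \sum_i \sum_k derive1 V y i k * 'D_((0 : R), delta_mx i k) G (y, V y).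
apply: (diff_times_on_eq Jo (f := F)).
  by move=> y; rewrite inE => Jy; rewrite (cG y Jy).2.
apply: (diff_times_onD Jo); first exact: (IH _ (smooth_on_derive _ sG)).
apply: diff_times_on_sum => [|i]; first exact: Jo.
apply: diff_times_on_sum => [|j]; first exact: Jo.
apply: (diff_times_onM Jo); last exact: (IH _ (smooth_on_derive _ sG)).
have /diff_times_onS[_ dV'] := dV k.+1.
exact: (diff_times_on_mx _ _ Jo).1 dV' i j.
Qed.

End PartialDerivatives.

(** * Jets of solutions *)

Section JetsOfSolutions.
Context {R : realType}.

Lemma dotE {m p} (a b : 'M[R]_(m, p)) : dot a b = \sum_i \sum_k a i k * b i k.
Proof.
rewrite /dot /mxtrace exchange_big/=; apply: eq_bigr => k _.
by rewrite mxE; apply: eq_bigr => i _; rewrite mxE.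
Qed.

Lemma derive1n_scaleB J (c : R) (f g : R -> R) k : open J ->
  diff_times_on k J f -> diff_times_on k J g ->
  {in J, derive1n k (fun y => c * (f y - g y)) =1
    fun y => c * (derive1n k f y - derive1n k g y)}.
Proof.
move=> Jo; elim: k => [//|k IH] df dg x; rewrite inE => Jx.
have Jx' : x \in J by rewrite inE.
have {}IH := IH (diff_times_on_leq (leqnSn k) df) (diff_times_on_leq (leqnSn k) dg).
rewrite !derive1nS (derive1_eq_on Jo IH Jx').
have dfk := df k (ltnSn k) x Jx; have dgk := dg k (ltnSn k) x Jx.
have dB : derivable (fun y => derive1n k f y - derive1n k g y) x 1.
  exact: derivableB.
by rewrite (derive1Zl c dB) !derive1E; congr (_ * _); exact: deriveB.
Qed.

Lemma jetE n N J (z : R -> 'cV[R]_n) i (k : 'I_N.+1) : open J -> smooth_on J z ->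
  {in J, (fun x => jet N z x i k) =1 derive1n k (fun y => z y i 0)}.
Proof.
move=> Jo sz x Jx; rewrite mxE.
have dz := (smooth_on1P z Jo).1 sz k.
exact: (derive1n_mx i 0 Jo dz (leqnn k) Jx).
Qed.

Context {n : nat} (J T : set R) (Jo : open J) (To : open T).
Variable z : R -> R -> 'cV[R]_n.
Hypothesis z_smooth : smooth_on (J `*` T) (fun xt : R * R => z xt.1 xt.2).

Let U : set (R * R) := J `*` T.
Let Z i (xt : R * R) : R := z xt.1 xt.2 i 0.
Let dx : R * R := (1, 0).
Let dt : R * R := (0, 1).
Let Zx k i := iter k (fun g => 'D_dx g) (Z i).

Let Uo : open U.
Proof.
rewrite openE => -[x t] [/= Jx Tt]; exists (J, T) => //=.
by split; apply: open_nbhs_nbhs.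
Qed.

Let sZ i : smooth_on U (Z i). Proof. exact: (smooth_on_entry Uo i 0 z_smooth). Qed.

Lemma smooth_on_section t : T t -> smooth_on J (z^~ t).
Proof.
move=> Tt; apply/(smooth_on1P _ Jo) => k l _ x Jx.
have -> : derive1n l (z^~ t) = fun y =>
    iter l (fun g => 'D_dx g) (fun xt : R * R => z xt.1 xt.2) (y, t).
  by apply/funext => y; rewrite iter_derive_fst.
have dl := smooth_on_differentiable (smooth_on_iter dx l z_smooth) (conj Jx Tt : U (x, t)).
have dc : derivable (fun y : R => (y, t)) x 1.
  by apply/derivable1_diffP/differentiable_pair.
exact: (diff_comp_curve dl dc).1.
Qed.

(** Mixed partial derivatives commute; this brings the time derivative of the
    density into the form of the sum in [energy_flux]. *)
Lemma jet_derive_time N x t : J x -> T t ->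
  derivable (fun s => jet N (z^~ s) x) t 1 /\
  forall i (k : 'I_N.+1), derive1 (fun s => jet N (z^~ s) x) t i k =
    derive1n k (fun y => derive1 (z y) t i 0) x.
Proof.
move=> Jx Tt.
have jE i (k : 'I_N.+1) :
    {in T, (fun s => Zx k i (x, s)) =1 (fun s => jet N (z^~ s) x i k)}.
  move=> s; rewrite inE => Ts; have Jx' : x \in J by rewrite inE.
  have /= -> := jetE i k Jo (smooth_on_section Ts) Jx'.
  by rewrite /Zx iter_derive_fst.
have dZ i k y s : J y -> T s ->
    differentiable (iter k (fun g => 'D_dx g) (Z i)) (y, s).
  move=> Jy Ts; have Uys : U (y, s) := conj Jy Ts.
  exact: (smooth_on_differentiable (smooth_on_iter dx k (sZ i)) Uys).
have dinr (y s : R) : derivable (fun s : R => (y, s)) s 1.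
  by apply/derivable1_diffP/differentiable_pair.
have dj : derivable (fun s => jet N (z^~ s) x) t 1.
  apply/derivable_mxP => i k; apply: (derivable_eq_on To Tt (jE i k)).
  exact: (diff_comp_curve (dZ i k x t Jx Tt) (dinr x t)).1.
split=> // i k.
have Tt' : t \in T by rewrite inE.
have Jx' : x \in J by rewrite inE.
rewrite derive1_mx// -(derive1_eq_on To (jE i k) Tt').
rewrite derive1E -derive_snd.
have Uxt : (x, t) \in U by rewrite inE.
rewrite -(derive_iter_commute Uo dx dt k (sZ i) Uxt) iter_derive_fst.
apply: (derive1n_eq_on _ Jo) => // y; rewrite inE => Jy.
rewrite derive_snd -derive1E derive1_mx//.
have dzy := smooth_on_differentiable z_smooth (conj Jy Tt : U (y, t)).
exact: (diff_comp_curve dzy (dinr y t)).1.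
Qed.

End JetsOfSolutions.

(** * Conservation of energy *)

Theorem proposition2 (R : realType) (n N r : nat) (X : set R)
    (K : 'I_r.+1 -> R -> 'M[R]_n)
    (H : R -> 'M[R]_(n, N.+1) -> R)
    (dg : ('M[R]_(n, N.+1) -> R) ->
          'M[R]_(n, N.+1) -> 'M[R]_(n, N.+1) -> 'M[R]_(n, N.+1))
    (dt : R) :
  open_interval X ->
  (forall k, smooth_on X (K k)) ->
  skew_adjoint_on X K ->
  smooth_on (X `*` setT) (fun xv : R * 'M[R]_(n, N.+1) => H xv.1 xv.2) ->
  discrete_gradient dg ->
  dt != 0 ->
  exists (q : nat) (C : 'I_q.+1 -> 'I_q.+1 -> R -> 'M[R]_(n * N.+1)),
    [/\ (forall j k, smooth_on X (C j k)),
        ((forall k, constant_on X (K k)) -> forall j k, constant_on X (C j k)),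
        (forall (J T : set R) (z : R -> R -> 'cV[R]_n),
          let v x t := jet N (z^~ t) x in
          let h t x := grad (H x) (v x t) in
          open_interval J -> J `<=` X -> open_interval T ->
          smooth_on (J `*` T) (fun xt : R * R => z xt.1 xt.2) ->
          (forall x t, J x -> T t ->
            derive1 (z x) t = diffop K (euler (h t)) x) ->
          forall x t, J x -> T t ->
            [/\ derivable (fun s => H x (v x s)) t 1,
                derivable (quad_diff_form C (h t)) x 1 &
                derive1 (fun s => H x (v x s)) t
                  + derive1 (quad_diff_form C (h t)) x = 0])
      & (forall (J : set R) (z0 z1 : R -> 'cV[R]_n),
          let h x := dg (H x) (jet N z0 x) (jet N z1 x) in
          open_interval J -> J `<=` X ->
          smooth_on J z0 -> smooth_on J z1 ->
          (* h is differentiable as often as is written below *)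
          diff_times_on (maxn (N + r) q.+1) J h ->
          (forall x, J x ->
            dt^-1 *: (z1 x - z0 x) = diffop K (euler h) x) ->
          forall x, J x ->
            derivable (quad_diff_form C h) x 1 /\
            (H x (jet N z1 x) - H x (jet N z0 x)) / dt
              + derive1 (quad_diff_form C h) x = 0)].
Proof.
move=> [Xo _] sK skK sH dgP dt0.
have [C [sC cC eC]] := @energy_flux R X Xo n N r K sK skK.
exists (N + r + N)%N, C; split=> // [J T z v h|J z0 z1 h].
- move=> [Jo _] JX [To _] sz zP x t Jx Tt.
  have Hd y u : X y -> differentiable (H y) u.
    move=> Xy; apply: (smooth_on_differentiable (U := setT)) => //.
    exact: (smooth_slice sH Xy).
  have dv k : diff_times_on k J (v^~ t).
    apply/(diff_times_on_mx _ _ Jo) => i j.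
    have szt := smooth_on_section Jo sz Tt.
    apply: (diff_times_on_eq Jo (f := derive1n j (fun y => z y t i 0))).
      by move=> y Jy; have /= -> := jetE i j Jo szt Jy.
    apply: diff_times_on_derive1n.
    exact: (diff_times_on_mx _ _ Jo).1 ((smooth_on1P _ Jo).1 szt _) i 0.
  have hJ : admissible X (N + r + N) J (h t).
    split=> //; apply/(diff_times_on_mx _ _ Jo) => i j.
    pose G (yu : R * 'M[R]_(n, N.+1)) := H yu.1 yu.2.
    have -> : (fun y => h t y i j) =
        fun y => 'D_((0 : R), delta_mx i j) G (y, v y t).
      by apply/funext => y; rewrite mxE derive_snd.
    have JXT y : J y -> (X `*` setT) (y, v y t) by move=> Jy; split=> //; exact: JX.
    have sG := smooth_on_derive ((0 : R), delta_mx i j) sH.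
    exact: (diff_times_on_comp Jo dv JXT sG).
  have [dQ eQ] := eC J (h t) x hJ Jx.
  have [dj ej] := jet_derive_time Jo To sz N Jx Tt.
  have [dHs eHs] := diff_comp_curve (Hd x (v x t) (JX x Jx)) dj.
  split=> //; rewrite eQ eHs diff_mx_entries; last exact: Hd (JX x Jx).
  apply/eqP; rewrite subr_eq0; apply/eqP.
  apply: eq_bigr => i _; apply: eq_bigr => k _; rewrite mxE mulrC; congr (_ * _).
  rewrite ej; apply: (derive1n_eq_on _ Jo); last by rewrite inE.
  by move=> y; rewrite inE => Jy; rewrite zP.
- move=> [Jo _] JX sz0 sz1 dh zP x Jx.
  have hJ : admissible X (N + r + N) J h.
    by split=> //; apply: diff_times_on_leq dh; rewrite leq_max leqnSn orbT.
  have [dQ eQ] := eC J h x hJ Jx.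
  split=> //; rewrite eQ -(dgP _ (smooth_slice sH (JX x Jx))) dotE.
  apply/eqP; rewrite subr_eq0; apply/eqP; rewrite mulr_suml.
  apply: eq_bigr => i _; rewrite mulr_suml; apply: eq_bigr => k _.
  rewrite mulrAC [RHS]mulrC; congr (_ * _).
  have Jx' : x \in J by rewrite inE.
  have dz (z' : R -> 'cV[R]_n) : smooth_on J z' ->
      forall l, diff_times_on l J (fun y => z' y i 0).
    by move=> sz l; exact: (diff_times_on_mx _ _ Jo).1 ((smooth_on1P _ Jo).1 sz l) i 0.
  transitivity (derive1n k (fun y => dt^-1 * (z1 y i 0 - z0 y i 0)) x); last first.
    apply: (derive1n_eq_on _ Jo) => // y; rewrite inE => Jy.
    by rewrite -zP// !mxE.
  have /= -> := derive1n_scaleB dt^-1 Jo (dz _ sz1 k) (dz _ sz0 k) Jx'.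
  have /= E1 := jetE i k Jo sz1 Jx'; have /= E0 := jetE i k Jo sz0 Jx'.
  by rewrite !mxE -{}E1 -{}E0 !mxE mulrC.
Qed.
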